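(* Let $n\ge 1$ and $\overline{R}$ be integers with $0\le \overline{R}\le n$, and let $n_{\overline{R}}:=\overline{R}(\overline{R}+1)/2$. Then $K^+(n,n-\overline{R})\ge \overline{R}+1$, with equality when $n\ge n_{\overline{R}}$. Furthermore, $n_{\overline{R}}$ is the least value for which equality holds, in the sense that $K^+(n,n-\overline{R})>\overline{R}+1$ whenever $n<n_{\overline{R}}$.
   Context: $Q_n=\{0,1\}^n$ is ordered by $x\preceq y$ iff $x_i\le y_i$ for all $i$, and $d(x,y)$ is the Hamming distance. The downward directed ball is $B_n^-(x,R)=\{y\in Q_n: y\preceq x,\ d(x,y)\le R\}$. A set $\mathcal{C}\subseteq Q_n$ downward $R$-covers $Q_n$ if $Q_n=\bigcup_{c\in\mathcal{C}}B_n^-(c,R)$. $K^+(n,R)$ denotes the minimum size of a set $\mathcal{C}\subseteq Q_n$ that downward $R$-covers $Q_n$ (in particular $K^+(n,R)=1$ for $R\ge n$). *)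

(* Defs.v *)
From mathcomp Require Import all_boot.

Set Implicit Arguments.
Unset Strict Implicit.
Unset Printing Implicit Defensive.

Definition Q (n : nat) := {ffun 'I_n -> bool}.

Definition leQ n (x y : Q n) : bool := [forall i, x i <= y i].

Definition hamming n (x y : Q n) : nat := #|[set i | x i != y i]|.

Definition down_ball n (x : Q n) (R : nat) : {set Q n} :=
  [set y | leQ y x && (hamming x y <= R)].

Definition down_covers n (R : nat) (C : {set Q n}) : bool :=
  [set: Q n] == \bigcup_(c in C) down_ball c R.

Lemma down_covers_setT n R : down_covers R [set: Q n].
Proof.
rewrite /down_covers eq_sym -subTset; apply/subsetP=> x _.
apply/bigcupP; exists x; rewrite // inE; apply/andP; split.
  by apply/forallP.
rewrite /hamming (_ : [set _ | _] = set0) ?cards0 //.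
by apply/setP=> i; rewrite !inE eqxx.
Qed.

(* The default [set: Q n] of the arg min is itself a cover, by
   down_covers_setT, so Kplus is a genuine minimum; see KplusP. *)
Definition Kplus (n R : nat) : nat :=
  #|[arg min_(C < [set: Q n] | down_covers R C) #|C| ]|.

Lemma KplusP n R :
  (exists2 C : {set Q n}, down_covers R C & #|C| = Kplus n R) /\
  (forall C : {set Q n}, down_covers R C -> Kplus n R <= #|C|).
Proof.
rewrite /Kplus; case: arg_minnP => [|C covC minC].
  exact: down_covers_setT.
by split=> //; exists C.
Qed.

Definition triangular (r : nat) : nat := (r * r.+1) %/ 2.

(* Main.v *)
Require Import Defs.
From mathcomp Require Import all_boot.
From mathcomp Require Import zify.

Set Implicit Arguments.
Unset Strict Implicit.
Unset Printing Implicit Defensive.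

(** Identify a word with the set of its zeros and let [r = Rbar]. Then [C]
    covers iff every set [S] of coordinates is disjoint from the zero set [A] of
    some codeword with [r <= #|A| + #|S|]. Applying this to transversals [S] of
    the zero sets of size [> k] shows that there are at least [r - k] of these
    for every [k < r]. With only [r + 1] codewords, two nonempty zero sets
    cannot meet, since a common point would save one element in a transversal;
    so they are disjoint and their total size, at least
    [r + (r - 1) + ... + 1], is at most [n]. Conversely, disjoint zero sets of
    sizes [0, 1, ..., r] give a cover by the pigeonhole principle. *)

(** * Lower bounds for avoiding families *)

Section AvoidingFamilies.

Variable T : finType.
Implicit Types (A B D S : {set T}) (F : {set {set T}}).

(** The covering condition read on zero sets: [S] is the set of ones of the word to be covered, [A]
    the zero set of a codeword covering it. *)
Definition avoiding (r : nat) F : Prop :=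
  forall S, exists A : {set T}, [/\ A \in F, [disjoint A & S] & r <= #|A| + #|S|].

Lemma transversal_exists F : set0 \notin F ->
  exists2 S : {set T}, #|S| <= #|F| & (forall A, A \in F -> ~~ [disjoint A & S]).
Proof.
move=> F0; case: (pickP T) => [x0 _|T0]; last first.
  exists set0 => [|A AF]; first by rewrite cards0.
  have A0 : A = set0 by apply/setP => x; have := T0 x.
  by rewrite A0 (negPf F0) in AF.
pose f A := odflt x0 [pick x in A].
exists (f @: F) => [|A AF]; first exact: leq_imset_card.
have /set0Pn[y Ay] : A != set0 by apply: contraNneq F0 => <-.
have fA : f A \in A.
  by rewrite /f; case: pickP => [z|/(_ y)]; rewrite ?Ay.
by apply/pred0Pn; exists (f A); rewrite /= fA imset_f.
Qed.

(** One common point hits both [A] and [B]; one point for each of the other [#|F| - 2] members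
    completes the transversal. *)
Lemma transversal_meeting F A B : set0 \notin F ->
  A \in F -> B \in F -> A != B -> ~~ [disjoint A & B] ->
  exists2 S : {set T}, #|S| < #|F| & (forall D, D \in F -> ~~ [disjoint D & S]).
Proof.
move=> F0 AF BF AB /pred0Pn[x /andP[/= xA xB]].
pose G := F :\ A :\ B.
have [|S leS hitS] := @transversal_exists G.
  by rewrite !inE (negPf F0) !andbF.
exists (x |: S) => [|D DF].
  have BFA : B \in F :\ A by rewrite !inE eq_sym AB.
  rewrite cardsU1 (cardsD1 A F) AF (cardsD1 B (F :\ A)) BFA -/G.
  by rewrite !add1n ltnS -add1n; apply: leq_add leS; apply: leq_b1.
have hitx (E : {set T}) : x \in E -> ~~ [disjoint E & x |: S].
  by move=> xE; apply/pred0Pn; exists x; rewrite /= xE setU11.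
have [->|DA] := eqVneq D A; first exact: (hitx _ xA).
have [->|DB] := eqVneq D B; first exact: (hitx _ xB).
have /hitS/pred0Pn[y /andP[/= yD yS]] : D \in G by rewrite !inE DA DB DF.
by apply/pred0Pn; exists y; rewrite /= yD setU1r.
Qed.

(** A member disjoint from a transversal [S] of the members larger than [k] has size at most [k],
    whence [r <= k + #|S|]. *)
Lemma avoiding_card_gt r F k : avoiding r F -> k < r ->
  r - k <= #|[set A in F | k < #|A|]|.
Proof.
move=> avF ltkr; rewrite leqNgt; apply/negP => small.
have [|S leS hitS] := @transversal_exists [set A in F | k < #|A|].
  by rewrite inE cards0 ltn0 andbF.
have [A [AF dAS leA]] := avF S.
by have /hitS/negP[] : A \in [set A in F | k < #|A|] by rewrite inE AF; lia.
Qed.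

Lemma avoiding_card r F : avoiding r F -> r < #|F|.
Proof.
move=> avF; rewrite ltnNge; apply/negP => leF.
have [F0|F0] := boolP (set0 \in F).
  have cF : #|F| = #|F :\ set0|.+1 by rewrite (cardsD1 set0) F0.
  have r0 : 0 < r by lia.
  have := avoiding_card_gt avF r0.
  have -> : [set A in F | 0 < #|A|] = F :\ set0.
    by apply/setP => A; rewrite !inE card_gt0 andbC.
  by lia.
(* Without [set0], a transversal of all of [F] leaves no disjoint member. *)
have [S leS hitS] := transversal_exists F0.
by have [A [AF dAS _]] := avF S; move/negP: (hitS A AF).
Qed.

Lemma avoiding_disjoint r F : avoiding r F -> #|F| = r.+1 -> trivIset F.
Proof.
move=> avF cF; apply/trivIsetP => A B AF BF AB.
apply/negPn/negP => meet.
have [x /andP[/= xA xB]] := pred0Pn meet.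
have AF' : A \in F :\ set0 by rewrite !inE AF andbT; apply/set0Pn; exists x.
have BF' : B \in F :\ set0 by rewrite !inE BF andbT; apply/set0Pn; exists x.
have F0 : set0 \notin F :\ set0 by rewrite !inE eqxx.
have [S ltS hitS] := transversal_meeting F0 AF' BF' AB meet.
have [D [DF dDS leD]] := avF S.
(* [S] hits all nonempty members, so [D] is empty and [r <= #|S| < #|F :\ set0| = r]. *)
have [D0|D0] := eqVneq D set0.
  move: leD DF; rewrite D0 cards0 => leD DF.
  have cF0 : #|F| = #|F :\ set0|.+1 by rewrite (cardsD1 set0) DF.
  by lia.
by have /hitS/negP[] : D \in F :\ set0 by rewrite !inE D0.
Qed.

(** Double counting: [#|A|] bounds the number of [k < r] with [k < #|A|], and each [k] is counted by
    at least [r - k] members. *)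
Lemma avoiding_sum_card r F : avoiding r F ->
  'C(r.+1, 2) <= \sum_(A in F) #|A|.
Proof.
move=> avF.
have le_sum (a : nat) : \sum_(k < r) (k < a) <= a.
  suff -> : \sum_(k < r) (k < a) = minn r a by rewrite geq_minr.
  elim: r {avF} => [|p IHp]; first by rewrite big_ord0 min0n.
  by rewrite big_ord_recr /= IHp; lia.
apply: (@leq_trans (\sum_(A in F) \sum_(k < r) (k < #|A|))); last first.
  by apply: leq_sum => A _; apply: le_sum.
rewrite exchange_big /=.
have -> : 'C(r.+1, 2) = \sum_(k < r) (r - k).
  rewrite -bin2_sum big_nat_recl // add0n big_mkord.
  rewrite (reindex_inj rev_ord_inj) /=; apply: eq_bigr => k _.
  by have := ltn_ord k; lia.
apply: leq_sum => k _; apply: leq_trans (avoiding_card_gt avF (ltn_ord k)) _.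
rewrite -sum1_card big_mkcond [leqRHS]big_mkcond /=.
by apply: leq_sum => A _; rewrite inE; case: (A \in F); case: (k < #|A|).
Qed.

Lemma avoiding_tight r F : avoiding r F -> #|F| = r.+1 -> 'C(r.+1, 2) <= #|T|.
Proof.
move=> avF cF; apply: leq_trans (avoiding_sum_card avF) _.
by have /eqP-> := avoiding_disjoint avF cF; apply: max_card.
Qed.

End AvoidingFamilies.

(** * The extremal family of consecutive blocks *)

Definition block (n k : nat) : {set 'I_n} :=
  [set i : 'I_n | 'C(k, 2) <= i < 'C(k.+1, 2)].

(** The interval has length ['C(k.+1, 2) - 'C(k, 2) = k]; the hypothesis keeps it inside ['I_n]. *)
Lemma card_block n k : 'C(k.+1, 2) <= n -> #|block n k| = k.
Proof.
move=> le_n; rewrite -sum1_card.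
rewrite (eq_bigl (fun i : 'I_n => 'C(k, 2) <= i < 'C(k.+1, 2))); last first.
  by move=> i; rewrite inE.
rewrite -(big_mkord (fun i => 'C(k, 2) <= i < 'C(k.+1, 2)) (fun=> 1)).
rewrite sum1_count -size_filter.
have -> : [seq i <- index_iota 0 n | 'C(k, 2) <= i < 'C(k.+1, 2)]
          = index_iota 'C(k, 2) 'C(k.+1, 2).
  apply: (irr_sorted_eq ltn_trans ltnn).
  - exact/(sorted_filter ltn_trans)/iota_ltn_sorted.
  - exact: iota_ltn_sorted.
  - by move=> i; rewrite mem_filter !mem_index_iota; lia.
by rewrite size_iota binS bin1; lia.
Qed.

Lemma block_inj n k l (i : 'I_n) : i \in block n k -> i \in block n l -> k = l.
Proof.
wlog lt_kl : k l / k < l.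
  move=> W ik il; have [kl|lk|//] := ltngtP k l; first exact: W ik il.
  by rewrite (W _ _ lk il ik).
rewrite !inE => /andP[_ ik] /andP[li _].
by have := leq_bin2l 2 lt_kl; lia.
Qed.

Lemma avoiding_blocks n r : 'C(r.+1, 2) <= n ->
  avoiding r [set block n k | k : 'I_r.+1].
Proof.
move=> le_n S.
(* The index of the block containing [i]; the default at points outside all blocks is harmless, as
   [g @: S] still has at most [#|S|] elements. *)
pose g (i : 'I_n) : 'I_r.+1 := odflt ord0 [pick k : 'I_r.+1 | i \in block n k].
have card_k (k : 'I_r.+1) : #|block n k| = k.
  by apply: card_block; apply: leq_trans le_n; apply: leq_bin2l; apply: ltn_ord.
have [leS|ltS] := leqP r #|S|.
  exists (block n (@ord0 r)); split; first exact: imset_f.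
    by rewrite (cards0_eq (card_k ord0)) disjoints_subset sub0set.
  by rewrite card_k.
(* Indices of the blocks large enough for [S]: the values [r - j] with [j <= #|S|] are more than
   [#|S|] of them, so some [k] in [K] escapes [g @: S]. *)
pose K := [set k : 'I_r.+1 | r - #|S| <= k].
have cK : #|S| < #|K|.
  pose h (j : 'I_(#|S|.+1)) := rev_ord (widen_ord (ltnW ltS : #|S|.+1 <= r.+1) j).
  have inK j : h j \in K by rewrite inE /= subSS leq_sub2l // -ltnS.
  have h_inj : injective h by move=> i j /rev_ord_inj [] /ord_inj.
  have <- : #|[set h j | j : 'I_(#|S|.+1)]| = #|S|.+1 by rewrite card_imset ?card_ord.
  by apply/subset_leq_card/subsetP => _ /imsetP[j _ ->].
have /subsetPn[k kK kS] : ~~ (K \subset g @: S).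
  by apply/negP => /subset_leq_card/(leq_trans cK); rewrite ltnNge leq_imset_card.
exists (block n k); split; first exact: imset_f.
  apply/pred0Pn => -[i /andP[/= ik iS]]; case/negP: kS; apply/imsetP; exists i => //.
  rewrite /g; case: pickP => [l il|/(_ k)]; last by rewrite ik.
  exact/val_inj/(block_inj ik il).
by rewrite card_k; move: kK; rewrite inE; lia.
Qed.

(** * Translation between words and zero sets *)

Definition zeros n (x : Q n) : {set 'I_n} := [set i | ~~ x i].

Definition of_zeros n (A : {set 'I_n}) : Q n := [ffun i => i \notin A].

Lemma zerosK n : cancel (@zeros n) (@of_zeros n).
Proof. by move=> x; apply/ffunP => i; rewrite ffunE inE negbK. Qed.

Lemma of_zerosK n : cancel (@of_zeros n) (@zeros n).
Proof. by move=> A; apply/setP => i; rewrite inE ffunE negbK. Qed.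

(** A word [y] below [c] differs from it exactly on [zeros y :\: zeros c]. *)
Lemma in_down_ball n (c y : Q n) R :
  (y \in down_ball c R) =
    (zeros c \subset zeros y) && (#|zeros y| <= R + #|zeros c|).
Proof.
have -> : (y \in down_ball c R) = leQ y c && (hamming c y <= R) by rewrite inE.
have -> : leQ y c = (zeros c \subset zeros y).
  apply/forallP/subsetP => [le_yc i|sub i].
    by rewrite !inE; have := le_yc i; case: (y i); case: (c i).
  by have := sub i; rewrite !inE; case: (y i); case: (c i) => // /(_ isT).
case: (boolP (_ \subset _)) => //= sub.
have -> : hamming c y = #|zeros y :\: zeros c|.
  apply: eq_card => i; have := subsetP sub i.
  by rewrite !inE; case: (y i); case: (c i) => // /(_ isT).
by rewrite cardsD (setIidPr sub) leq_subLR addnC.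
Qed.

(** With [S] the complement of [zeros y], the bound [#|zeros y| <= n - r + #|zeros c|] becomes
    [r <= #|zeros c| + #|S|], since [r <= n]. *)
Lemma down_coversP n r (C : {set Q n}) : r <= n ->
  reflect (avoiding r (@zeros n @: C)) (down_covers (n - r) C).
Proof.
move=> le_rn; rewrite /down_covers eq_sym -subTset.
have cardC' (S : {set 'I_n}) : #|S| + #|~: S| = n by rewrite cardsC card_ord.
apply: (iffP subsetP) => [cov S|av y _].
  have /bigcupP[c cC] := cov (of_zeros (~: S)) (in_setT _).
  rewrite in_down_ball of_zerosK => /andP[sub le_c].
  exists (zeros c); split; [exact: imset_f | by rewrite disjoints_subset |].
  by have := cardC' S; lia.
have [_ [/imsetP[c cC ->] dis le_c]] := av (~: zeros y).
apply/bigcupP; exists c; rewrite // in_down_ball.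
rewrite -[zeros y in X in X && _]setCK -disjoints_subset dis /=.
rewrite -(leq_add2r #|~: zeros y|) cardC' -addnA.
by apply: leq_trans (leq_add (leqnn (n - r)) le_c); rewrite subnK.
Qed.

Lemma triangularE r : triangular r = 'C(r.+1, 2).
Proof. by rewrite bin2 /triangular divn2 mulnC. Qed.

Theorem theorem13 (n Rbar : nat) (n_ge1 : 1 <= n) (Rbar_le_n : Rbar <= n) :
  [/\ Rbar.+1 <= Kplus n (n - Rbar),
      triangular Rbar <= n -> Kplus n (n - Rbar) = Rbar.+1
    & n < triangular Rbar -> Rbar.+1 < Kplus n (n - Rbar)].
Proof.
have [[C covC cardC] minC] := KplusP n (n - Rbar).
have avC := elimT (down_coversP C Rbar_le_n) covC.
have cardZ : #|@zeros n @: C| = Kplus n (n - Rbar).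
  by rewrite card_imset //; apply: can_inj (@zerosK n).
have lower : Rbar < Kplus n (n - Rbar) by rewrite -cardZ; apply: avoiding_card.
rewrite triangularE; split=> // [le_n|lt_n].
  (* The words whose zero sets are the blocks form a small enough cover. *)
  apply/eqP; rewrite eqn_leq lower andbT.
  pose F := [set block n k | k : 'I_Rbar.+1].
  have cF : #|F| <= Rbar.+1.
    by apply: leq_trans (leq_imset_card _ _) _; rewrite card_ord.
  apply: leq_trans (leq_trans (leq_imset_card (@of_zeros n) F) cF).
  apply: minC; apply/down_coversP => //.
  rewrite -imset_comp (eq_imset _ (@of_zerosK n)) imset_id.
  exact: avoiding_blocks.
(* A minimum cover with [Rbar.+1] words would force ['C(Rbar.+1, 2) <= n]. *)
rewrite ltn_neqAle lower andbT; apply/eqP => cK.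
have := avoiding_tight avC (etrans cardZ (esym cK)).
by rewrite card_ord leqNgt lt_n.
Qed.
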